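(* Let $H$ be a history of a concurrent system. Then $H$ is linearizable if and only if, for each object $o$ of the system, the object subhistory $H|o$ is linearizable.
   Context: All orderings are strict (irreflexive). A concurrent system consists of a finite set of processes $p_i$ and a finite set of (shared) objects $o_x$, each object having a finite set of operations $op_y$; all are numbered by natural numbers. (Objects are built inductively: a register object is an atomic Boolean register with the operations Read, Write, CompAndSwap, And, Or, Not; a composite object consists of a finite set of subobjects and a finite set of operations, each a finite sequence of program statements, built with sequencing, if-then-else and while from operation calls on the subobjects. Distinct shared objects share no registers. In what follows an object enters only through its identifier and its sequential specification, defined below.) Events. An invocation event is $inv\langle i,j,x,y,args^*\rangle$ and a response event is $resp\langle i,j,x,y,term(res^* )\rangle$: it belongs to the $j$-th method call issued by process $p_i$, which calls operation $op_y$ of object $o_x$; the last entry is a payload (arguments, or termination condition with results). An invocation event and a response event match if they agree in $i,j,x,y$. Events are unique: each method call has one invocation event and at most one (matching) response event. Events of a single process, under the ordering considered, are isomorphic to a subset of the natural numbers. Histories. A history is a countable well-ordered structure $H=\langle E_H,\prec_H\rangle$ of invocation and response events such that: (1) $E_H$ is finitely partitioned into parts $E_i$, the events in $E_i$ being those with process id $i$; (2) (well-formedness) for each part $E_i$, its least element is an invocation event, and for $e_1\in E_i$, if $e_2$ is the least element of $E_i\cap\{e : e_1\prec_H e\}$ (if it exists), then $e_2$ is the response matching $e_1$ when $e_1$ is an invocation, and $e_2$ is an invocation when $e_1$ is a response. The empty history is allowed. Histories are equal if their event sets and orderings are equal. $H$ is a subhistory of $H'$, and $H'$ an extension of $H$,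 written $H\subseteq H'$, if $E_H\subseteq E_{H'}$ and $\prec_H\subseteq\prec_{H'}$. For $H\subseteq H'$, $H'-H$ is the structure with event set $E_{H'}\setminus E_H$ and the ordering restricted from $\prec_{H'}$. $H|p$ (process subhistory) and $H|o$ (object subhistory) are the maximal subhistories of $H$ all of whose events are by process $p$, respectively on object $o$. An invocation event in $H$ is pending if its matching response is not in $H$. $\mathrm{cmplt}(H)$ is the maximal subhistory of $H$ without pending invocation events. Two histories $H,H'$ are equivalent if $H|p=H'|p$ for every process $p$. For method calls $m,m'$ of $H$, write $m\prec_H m'$ if the response event of $m$ precedes the invocation event of $m'$ under $\prec_H$. A history is sequential if its least event (if any) is an invocation event and, for every event $e_1$, if $e_2$ is the least element of $\{e: e_1\prec e\}$ (if it exists), then $e_2$ is the response matching $e_1$ when $e_1$ is an invocation, and $e_2$ is an invocation when $e_1$ is a response. $H$ is a prefix of $H'$ if $H\subseteq H'$ and $e\prec_{H'}e'$ for all $e\in H$, $e'\in H'-H$. A set of histories is prefix-closed if it contains every prefix of each of its members. Each object $o$ comes with a sequential specification: a prefix-closed set of sequential histories all of whose events are on $o$. A sequential history $S$ is legal if $S|o$ belongs to the sequential specification of $o$ for every object $o$. Linearizability. A history $H$ is linearizable if: (L1) $H$ can be extended to a history $H'$ such that $H'-H$ contains only response events; (L2) $\mathrm{cmplt}(H')$ is equivalent to some legal sequential history $S$; (L3) for any two different method calls $m,m'$, if $m\prec_{\mathrm{cmplt}(H')}m'$ then $m\prec_S m'$. (The same $H'$ and $S$ are meant in L1–L3.) 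*)

(* Defs.v *)
From mathcomp Require Import all_boot finmap.
From mathcomp Require Import boolp classical_sets functions cardinality.
Set Implicit Arguments.
Unset Strict Implicit.
Unset Printing Implicit Defensive.
Local Open Scope classical_set_scope.

(* [Inv i j x y args] and [Resp i j x y t res] belong to the j-th method call of
   process i, which calls operation y of object x.  [V] is the type of values
   and [T] the type of termination conditions. *)
Inductive event (V T : Type) :=
  | Inv of nat & nat & nat & nat & seq V
  | Resp of nat & nat & nat & nat & T & seq V.

Section Structures.
Variables V T : Type.
Local Notation event := (event V T).
Implicit Types e r : event.

Definition is_inv e := if e is Inv _ _ _ _ _ then true else false.
Definition is_resp e := ~~ is_inv e.
Definition proc e := match e with Inv i _ _ _ _ | Resp i _ _ _ _ _ => i end.
Definition cidx e := match e with Inv _ j _ _ _ | Resp _ j _ _ _ _ => j end.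
Definition obj e := match e with Inv _ _ x _ _ | Resp _ _ x _ _ _ => x end.
Definition oper e := match e with Inv _ _ _ y _ | Resp _ _ _ y _ _ => y end.

(* A method call is identified by its process and its number in that process. *)
Definition call e : nat * nat := (proc e, cidx e).

Definition matching e r : Prop :=
  [/\ is_inv e, is_resp r, call e = call r, obj e = obj r & oper e = oper r].

(* The ordering is required to live on the event set in [strict_wo] below, so
   that Leibniz equality of structures is equality of event sets and orderings. *)
Record structure := Structure {
  ev : set event;
  prec : event -> event -> Prop }.
Implicit Types H K S : structure.

Definition least H (A : set event) e : Prop :=
  A e /\ forall e', A e' -> e' <> e -> prec H e e'.

Definition above H e : set event := [set e' | prec H e e'].

Definition strict_wo H : Prop :=
  [/\ forall e e', prec H e e' -> ev H e /\ ev H e',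
      forall e, ~ prec H e e,
      forall e1 e2 e3, prec H e1 e2 -> prec H e2 e3 -> prec H e1 e3,
      forall e e', ev H e -> ev H e' -> e <> e' -> prec H e e' \/ prec H e' e
    & forall A : set event, A `<=` ev H -> A !=set0 -> exists e, least H A e].

Definition alternating H (A : set event) : Prop :=
  (forall e, least H A e -> is_inv e) /\
  (forall e1 e2, A e1 -> least H (A `&` above H e1) e2 ->
     if is_inv e1 then matching e1 e2 else is_inv e2).

Definition part H (i : nat) : set event := ev H `&` [set e | proc e = i].

Definition restrict H (A : set event) : structure :=
  Structure (ev H `&` A) (fun e e' => [/\ prec H e e', A e & A e']).

Definition subhist H K : Prop :=
  ev H `<=` ev K /\ forall e e', prec H e e' -> prec K e e'.

Definition diff K H : structure := restrict K (~` ev H).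

Definition proj_proc H (i : nat) := restrict H [set e | proc e = i].
Definition proj_obj H (x : nat) := restrict H [set e | obj e = x].

Definition pending H e : Prop :=
  [/\ ev H e, is_inv e & ~ exists2 r, ev H r & matching e r].

Definition cmplt H := restrict H (~` pending H).

Definition call_prec H (m m' : nat * nat) : Prop :=
  exists r e, [/\ is_resp r /\ call r = m, is_inv e /\ call e = m' & prec H r e].

Definition prefix H K : Prop :=
  subhist H K /\ forall e e', ev H e -> ev (diff K H) e' -> prec K e e'.

End Structures.

(* The identifiers of the processes and objects of a system, and of the
   operations of each object. *)
Record signature := Signature {
  procs : {fset nat};
  objs : {fset nat};
  ops : nat -> {fset nat} }.

(* The partition of the events into the parts of the processes is finite because
   [procs] is. *)
Record history (V T : Type) (G : signature) (H : structure V T) : Prop := History {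
  hist_wo : strict_wo H;
  hist_countable : countable (ev H);
  hist_ids : forall e, ev H e ->
    [/\ proc e \in procs G, obj e \in objs G & oper e \in ops G (obj e)];
  hist_uniq : forall e e', ev H e -> ev H e' ->
    is_inv e = is_inv e' -> call e = call e' -> e = e';
  hist_omega : forall i, exists f : event V T -> nat, forall e e',
    part H i e -> part H i e' -> (prec H e e' <-> f e < f e');
  hist_wf : forall i, alternating H (part H i) }.

Definition sequential (V T : Type) (G : signature) (H : structure V T) : Prop :=
  history G H /\ alternating H (ev H).

Definition prefix_closed (V T : Type) (G : signature)
    (P : set (structure V T)) : Prop :=
  forall S K, P S -> history G K -> prefix K S -> P K.

Definition seq_spec (V T : Type) (G : signature) (x : nat)
    (P : set (structure V T)) : Prop :=
  (forall S, P S -> sequential G S /\ forall e, ev S e -> obj e = x) /\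
  prefix_closed G P.

Record system (V T : Type) := System {
  sig_of :> signature;
  spec : nat -> set (structure V T);
  specP : forall x, x \in objs sig_of -> seq_spec sig_of x (spec x) }.

Definition legal (V T : Type) (C : system V T) (S : structure V T) : Prop :=
  forall x, x \in objs C -> spec C x (proj_obj S x).

Definition equivalent (V T : Type) (G : signature) (H K : structure V T) : Prop :=
  forall i, i \in procs G -> proj_proc H i = proj_proc K i.

Definition linearizable (V T : Type) (C : system V T) (H : structure V T) : Prop :=
  exists H' S : structure V T,
  [/\ [/\ history C H', subhist H H' & forall e, ev (diff H' H) e -> is_resp e],
      [/\ sequential C S, legal C S & equivalent C (cmplt H') S]
    & forall m m', m <> m' -> call_prec (cmplt H') m m' -> call_prec S m m'].

(* [proj_proc], [proj_obj] and [cmplt] are the maximal subhistories they stand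
   for. *)
Definition greatest_subhist (V T : Type) (G : signature) (H : structure V T)
    (P : structure V T -> Prop) (K : structure V T) : Prop :=
  [/\ history G K, subhist K H, P K
    & forall K', history G K' -> subhist K' H -> P K' -> subhist K' K].

Section Restrict.
Variables (V T : Type) (G : signature) (H : structure V T).
Hypothesis hH : history G H.

Lemma prec_evl e e' : prec H e e' -> ev H e.
Proof. by case: (hist_wo hH) => h _ _ _ _ /h[]. Qed.

Lemma prec_evr e e' : prec H e e' -> ev H e'.
Proof. by case: (hist_wo hH) => h _ _ _ _ /h[]. Qed.

Lemma prec_irr e : ~ prec H e e.
Proof. by case: (hist_wo hH). Qed.

Lemma prec_trans e1 e2 e3 : prec H e1 e2 -> prec H e2 e3 -> prec H e1 e3.
Proof. by case: (hist_wo hH) => _ _ h _ _; exact: h. Qed.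

Lemma prec_total e e' :
  ev H e -> ev H e' -> e <> e' -> prec H e e' \/ prec H e' e.
Proof. by case: (hist_wo hH) => _ _ _ h _; exact: h. Qed.

Lemma prec_least (A : set (event V T)) :
  A `<=` ev H -> A !=set0 -> exists e, least H A e.
Proof. by case: (hist_wo hH) => _ _ _ _ h; exact: h. Qed.

Lemma resp_pred r : ev H r -> is_resp r ->
  exists e, [/\ part H (proc r) e, matching e r
    & least H (part H (proc r) `&` above H e) r].
Proof.
move=> Hr rr; set i := proc r.
have Pr : part H i r by [].
have [f fP] := hist_omega hH i.
have [w1 w2] := hist_wf hH i.
have [e0 [Pe0 e0r]] : exists e, part H i e /\ prec H e r.
  apply: contrapT => no.
  suff /w1 ir : least H (part H i) r by move: rr; rewrite /is_resp ir.
  split=> // e' Pe' ne; case: (prec_total Hr Pe'.1) => //; first by move=> E; exact: ne.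
  by move=> e'r; case: no; exists e'.
pose p n := `[< exists e, [/\ part H i e, prec H e r & f e = n] >].
have exp : exists n, p n by exists (f e0); apply/asboolP; exists e0.
have bp n : p n -> n <= f r.
  by move/asboolP => [e [Pe er <-]]; apply/ltnW/fP.
case: (ex_maxnP exp bp) => n /asboolP[e [Pe er fe]] mx.
have L : least H (part H i `&` above H e) r.
  split=> // e' [Pe' ee'] ne.
  case: (prec_total Hr Pe'.1) => //; first by move=> E; exact: ne.
  move=> e'r; have : f e' <= n by apply: mx; apply/asboolP; exists e'.
  by rewrite -fe leqNgt; move/negP; case; exact/fP.
exists e; split=> //.
have := w2 _ _ Pe L; case: ifP => // _ ir; by move: rr; rewrite /is_resp ir.
Qed.

Lemma restrict_history (A : set (event V T)) :
  (forall e r, ev H e -> ev H r -> matching e r -> A e <-> A r) ->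
  history G (restrict H A).
Proof.
move=> cA; split.
- split=> /=.
  + move=> e e' [ee' Ae Ae'].
    by split; split=> //; [exact: prec_evl ee'|exact: prec_evr ee'].
  + by move=> e [/prec_irr].
  + move=> e1 e2 e3 [h1 a1 _] [h2 _ a3]; split=> //; exact: prec_trans h1 h2.
  + move=> e e' [He Ae] [He' Ae'] ne; case: (prec_total He He' ne); by [left|right].
  + move=> B BA B0; have [|e [Be eB]] := @prec_least B _ B0; first by move=> x /BA[].
    exists e; split=> // e' Be' ne; have [_ ?] := BA _ Be; have [_ ?] := BA _ Be'.
    by split=> //; exact: eB.
- by apply: sub_countable (hist_countable hH); apply: subset_card_le => e [].
- by move=> e [He _]; exact: hist_ids hH _ He.
- by move=> e e' [He _] [He' _]; exact: (hist_uniq hH).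
- move=> i; have [f fP] := hist_omega hH i.
  exists f => e e' [[He Ae] ei] [[He' Ae'] ei'] /=.
  have h := fP e e' (conj He ei) (conj He' ei').
  by split=> [[/h]|/h].
move=> i; split.
- move=> e [[[He Ae] ei] eL]; apply: contrapT => /negP re.
  have [e0 [[He0 e0i] m L]] := resp_pred He re.
  have Ae0 : A e0 by exact/(cA _ _ He0 He m).
  have ne : e0 <> e by move=> E; case: L => [[_]]; rewrite /above/= E => /prec_irr.
  have [|pe _ _] := eL e0 _ ne; first by split=> //; rewrite /= e0i.
  case: L => [[_ pe0] _]; exact: prec_irr (prec_trans pe pe0).
move=> e1 e2 [[He1 Ae1] e1i] [[[[He2 Ae2] e2i] [/= e12 _ _]] L2].
case: ifP => i1.
  have [||s Ls] := @prec_least (part H i `&` above H e1).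
  - by move=> x [[]].
  - by exists e2.
  have m := (hist_wf hH i).2 e1 s (conj He1 e1i) Ls; rewrite i1 in m.
  have [[[Hs si] e1s] sL] := Ls.
  have As : A s by exact/(cA _ _ He1 Hs m).
  suff -> : e2 = s by [].
  apply: contrapT => ne.
  have e2s : prec H e2 s.
    have [|//] := L2 s _ (fun E => ne (esym E)).
    by split.
  have se2 : prec H s e2 by apply: sL.
  exact: prec_irr (prec_trans e2s se2).
apply: contrapT => /negP re.
have [e0 [[He0 /= e0i] m [[_ e02] L]]] := resp_pred He2 re.
have Ae0 : A e0 by exact/(cA _ _ He0 He2 m).
have i0 : is_inv e0 by case: m.
have n01 : e0 <> e1 by move=> E; rewrite E i1 in i0.
have [e01|e10] := prec_total He0 He1 n01.
  have n12 : e1 <> e2 by move=> E; rewrite E in e12; exact: prec_irr e12.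
  have e21 : prec H e2 e1.
    apply: L => //; split=> //; split=> //=; by rewrite e1i e2i.
  exact: prec_irr (prec_trans e12 e21).
have n02 : e0 <> e2 by move=> E; rewrite E in e02; exact: prec_irr e02.
have [|e20 _ _] := L2 e0 _ n02.
  by split; [split=> //; rewrite /= e0i|split].
exact: prec_irr (prec_trans e02 e20).
Qed.

Lemma restrict_sub (A : set (event V T)) : subhist (restrict H A) H.
Proof. by split=> [e []|e e' []]. Qed.

Lemma sub_restrict (A : set (event V T)) K : history G K -> subhist K H ->
  ev K `<=` A -> subhist K (restrict H A).
Proof.
move=> hK [s1 s2] KA; split=> [e Ke|e e' ee']; first by split; [exact: s1|exact: KA].
have [h _ _ _ _] := hist_wo hK; have [Ke Ke'] := h _ _ ee'.
by split; [exact: s2|exact: KA|exact: KA].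
Qed.

Lemma proj_proc_greatest i :
  greatest_subhist G H (fun K => forall e, ev K e -> proc e = i) (proj_proc H i).
Proof.
split; [|exact: restrict_sub|by move=> e []|by move=> K hK s; exact: sub_restrict].
by apply: restrict_history => e r _ _ [_ _ [E _] _ _] /=; rewrite E.
Qed.

Lemma proj_obj_greatest x :
  greatest_subhist G H (fun K => forall e, ev K e -> obj e = x) (proj_obj H x).
Proof.
split; [|exact: restrict_sub|by move=> e []|by move=> K hK s; exact: sub_restrict].
by apply: restrict_history => e r _ _ [_ _ _ E _] /=; rewrite E.
Qed.

Lemma cmplt_greatest :
  greatest_subhist G H (fun K => forall e, ~ pending K e) (cmplt H).
Proof.
split; [|exact: restrict_sub| |].
- apply: restrict_history => e r He Hr m; split=> _.
    by case=> _ ir _; case: m => _; rewrite /is_resp ir.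
  by case=> _ _; apply; exists r.
- move=> e [[He npe] ie nex]; apply: npe; split=> // -[r Hr m]; apply: nex.
  exists r => //; split=> //= -[_ ir _].
  by case: m => _; rewrite /is_resp ir.
- move=> K hK s nK; apply: sub_restrict => // e Ke [_ ie nex].
  apply: (nK e); split=> // -[r Kr m]; apply: nex; exists r => //.
  exact: s.1.
Qed.

End Restrict.

(* Main.v *)
(* For the hard direction, append to H all the responses that complete the
   histories H|o, ordered by process; they belong to pending calls, so there is at
   most one per process.  Let K be the completion of this history and let S_o
   linearize H|o.  On the calls of K, take the union of the precedence of K and of
   the precedences of the S_o.  If p precedes q in K, q is equal to p' or before p'
   in some S_o, and p' precedes q' in K, then the invocation of q comes before the
   response of p', so that p precedes q' in K.  Hence the transitive closure of the
   union has an explicit form, from which it is seen to be irreflexive.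

   Histories may be transfinite, so a linear extension has to be a well-order.
   Send a call m to the family, over the processes i, of the sets of calls of i that
   are below or equal to m.  These are initial segments of the well-ordered calls of
   i, so the lexicographic order of the families, for the finitely many processes,
   is a well-order.  It extends the partial order: the families increase with m, and
   strictly so because the family of m contains m itself. *)
Require Import Defs.
From mathcomp Require Import all_boot finmap.
From mathcomp Require Import boolp classical_sets functions cardinality.
Set Implicit Arguments.
Unset Strict Implicit.
Unset Printing Implicit Defensive.
Local Open Scope classical_set_scope.

(** * Calls, matching and pending invocations in one history *)

Section HistoryTheory.
Variables (V T : Type) (G : signature) (H : structure V T).
Hypothesis hH : history G H.
Implicit Types (e r : event V T) (m : nat * nat) (A : set (event V T)).

Lemma prec_neq e e' : prec H e e' -> e <> e'.
Proof. by move=> p E; rewrite E in p; have := prec_irr hH p. Qed.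

Lemma prec_asym e e' : prec H e e' -> ~ prec H e' e.
Proof. by move=> p q; apply: (prec_irr hH (prec_trans hH p q)). Qed.

(** The response has a matching invocation before it, and this is [e] because a call has only one
    invocation. *)
Lemma inv_resp e r : ev H e -> ev H r -> is_inv e -> is_resp r ->
  call e = call r -> matching e r /\ prec H e r.
Proof.
move=> He Hr ie rr c; have [e0 [[He0 _] m0 [[_ p0] _]]] := resp_pred hH Hr rr.
have [i0 _ c0 _ _] := m0.
by suff -> : e = e0 by []; apply: (hist_uniq hH) => //; rewrite ?i0 ?ie ?c ?c0.
Qed.

Lemma matching_prec e r : ev H e -> ev H r -> matching e r -> prec H e r.
Proof. by move=> He Hr [ie rr c _ _]; have [] := inv_resp He Hr ie rr c. Qed.

Lemma resp_uniq e r r' : ev H r -> ev H r' -> matching e r -> is_resp r' ->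
  call r' = call e -> r' = r.
Proof.
move=> Hr Hr' [_ rr c _ _] rr' c'; apply: (hist_uniq hH) => //.
  by move: rr rr'; rewrite /is_resp => /negbTE -> /negbTE.
by rewrite c' c.
Qed.

Lemma same_call_obj e e' : ev H e -> ev H e' -> call e = call e' ->
  obj e = obj e'.
Proof.
move=> He He' c; case ie: (is_inv e); case ie': (is_inv e').
- by rewrite (hist_uniq hH He He') ?ie.
- by have [|[]] := inv_resp He He' ie _ c; rewrite /is_resp ?ie'.
- by have [|[]] := inv_resp He' He ie' _ (esym c); rewrite /is_resp ?ie.
- by rewrite (hist_uniq hH He He') ?ie.
Qed.

(** The response of [m] is its last event and the invocation of [m'] its first. *)
Lemma call_prec_prec m m' e e' : call_prec H m m' -> ev H e -> ev H e' ->
  call e = m -> call e' = m' -> prec H e e'.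
Proof.
move=> [r [i [[rr cr] [ii ci] p]]] He He' ce ce'.
have Hr := prec_evl hH p; have Hi := prec_evr hH p.
have {}p : prec H e i.
  case ie: (is_inv e); last by rewrite (hist_uniq hH He Hr) // ?ce // (negbTE rr).
  have [|_ q] := inv_resp He Hr ie rr; first by rewrite ce.
  exact: (prec_trans hH q p).
case ie': (is_inv e'); first by rewrite (hist_uniq hH He' Hi) // ?ce' // ii.
have [||_ q] := inv_resp Hi He' ii; rewrite /is_resp ?ie' ?ce' //.
exact: (prec_trans hH p q).
Qed.

Lemma call_prec_irr m : ~ call_prec H m m.
Proof.
move=> p; have [r [e [[_ c] _ q]]] := p.
have Hr := prec_evl hH q; exact: (prec_irr hH (call_prec_prec p Hr Hr c c)).
Qed.

Lemma call_prec_trans m m' m'' :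
  call_prec H m m' -> call_prec H m' m'' -> call_prec H m m''.
Proof.
move=> p [r [e [[_ cr] ie q]]]; have [r0 [e0 [[rr0 cr0] _ q0]]] := p.
exists r0, e; split=> //; apply: (prec_trans hH _ q).
exact: call_prec_prec p (prec_evl hH q0) (prec_evl hH q) cr0 cr.
Qed.

(** Otherwise the process has a next event after [e], and well-formedness makes it a response
    matching [e]. *)
Lemma pending_last e e' : pending H e -> ev H e' -> proc e' = proc e ->
  e' = e \/ prec H e' e.
Proof.
move=> [He ie nex] He' pe; have [|ne] := EM (e' = e); first by left.
have [|p] := prec_total hH He' He ne; [by right|case: nex].
have [||r Lr] := prec_least hH (A := part H (proc e) `&` above H e).
- by move=> x [[]].
- by exists e'.
have := (hist_wf hH (proc e)).2 e r (conj He erefl) Lr; rewrite ie => m.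
by exists r => //; case: Lr => [[[]]].
Qed.

(** Such a set takes or leaves each call as a whole. Process parts and the whole event set are of
    this kind, so one argument serves well-formedness and sequentiality. *)
Definition match_closed A := forall e r, ev H e -> ev H r -> matching e r ->
  (A e <-> A r).

Lemma match_closed_part {i} : match_closed (part H i).
Proof.
by move=> e r He Hr [_ _ [E _] _ _]; split=> -[_ /= <-]; split=> //=; rewrite E.
Qed.

Lemma match_closed_ev : match_closed (ev H).
Proof. by []. Qed.

(** Calls cannot overlap inside an alternating set, because an invocation is followed at once by its
    response. *)
Lemma alternating_cases A e e' : A `<=` ev H -> match_closed A ->
    alternating H A -> A e -> A e' -> prec H e e' ->
  [/\ call e = call e', is_inv e & is_resp e'] \/ call_prec H (call e) (call e').
Proof.
move=> AH cA [_ alt] Ae Ae' p.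
have succ a b : A a -> A b -> prec H a b -> is_inv a ->
    exists r, [/\ A r, matching a r & r = b \/ prec H r b].
  move=> Aa Ab ab ia; have [||r Lr] := prec_least hH (A := A `&` above H a).
  - by move=> x [/AH].
  - by exists b.
  have := alt _ _ Aa Lr; rewrite ia => m; have [[Ar _] rL] := Lr.
  exists r; split=> //; have [|ne] := EM (b = r); first by left.
  by right; apply: rL.
(* Take the invocation [i] of the call of [e']. If [e'] is its response, [e] cannot lie strictly
   between them, because the response is the next event of [A] after [i]. *)
have [i [Ai ii ci ei]] : exists i, [/\ A i, is_inv i, call i = call e' &
    e = i /\ is_resp e' \/ prec H e i].
  case ie': (is_inv e'); first by exists e'; split=> //; right.
  have re' : is_resp e' by rewrite /is_resp ie'.
  have [i [[Hi _] m _]] := resp_pred hH (AH _ Ae') re'.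
  have Ai : A i by apply/(cA _ _ Hi (AH _ Ae') m).
  have [ii _ ci _ _] := m; exists i; split=> //.
  have [|ne] := EM (e = i); first by left.
  have [|q] := prec_total hH (AH _ Ae) Hi ne; [by right|exfalso].
  have [r [Ar mr]] := succ _ _ Ai Ae q ii.
  rewrite (resp_uniq (AH _ Ae') (AH _ Ar) m) //; last 2 first.
  - by case: mr.
  - by case: mr.
  by case=> [E|q']; [apply: (prec_neq p)|apply: (prec_asym p)].
case: ei => [[-> re']|q]; [by left|right].
case ie: (is_inv e); last first.
  by exists e, i; split=> //; split=> //; rewrite /is_resp ie.
have [r [Ar [_ rr c _ _] [E|ri]]] := succ _ _ Ae Ai q ie.
  by move: rr; rewrite E /is_resp ii.
by exists r, i.
Qed.

Lemma alternating_call_total A e e' : A `<=` ev H -> match_closed A ->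
    alternating H A -> A e -> A e' -> call e <> call e' ->
  call_prec H (call e) (call e') \/ call_prec H (call e') (call e).
Proof.
move=> AH cA alt Ae Ae' ne.
have /(prec_total hH (AH _ Ae) (AH _ Ae'))[p|p] : e <> e'.
- by move=> E; apply: ne; rewrite E.
- by left; case: (alternating_cases AH cA alt Ae Ae' p) => // -[/ne].
- by right; case: (alternating_cases AH cA alt Ae' Ae p) => // -[/esym/ne].
Qed.

End HistoryTheory.

(** * Lexicographic comparison of families of sets *)

Section Lexicographic.
Variables (A : Type) (D : nat -> A -> set A).

Fixpoint lex (s : seq nat) (a b : A) : Prop :=
  if s is i :: s' then D i a `<` D i b \/ D i a = D i b /\ lex s' a b else False.

Lemma lex_irr s a : ~ lex s a a.
Proof. by elim: s => //= i s IH [[_]|[_]//]; apply. Qed.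

Lemma lex_trans s a b c : lex s a b -> lex s b c -> lex s a c.
Proof.
elim: s => //= i s IH [p|[-> q]] [p'|[<- q']]; [|by left|by left|].
  left; split; first exact: subset_trans p.1 p'.1.
  by move=> q; apply: p.2; exact: subset_trans p'.1 q.
by right; split=> //; exact: IH.
Qed.

(** The first index at which the inclusion is not an equality decides the comparison. *)
Lemma lex_mono s a b : (forall i, D i a `<=` D i b) ->
  (exists2 i, i \in s & ~ D i b `<=` D i a) -> lex s a b.
Proof.
move=> le; elim: s => [|i s IH] [j] //=; rewrite in_cons => js nle.
have [le'|nle'] := EM (D i b `<=` D i a); last by left.
right; split; first exact/seteqP.
by apply: IH; exists j => //; case/orP: js => // /eqP E; rewrite E in nle.
Qed.

Hypothesis D_least : forall i (B : set A), B !=set0 ->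
  exists2 a, B a & forall b, B b -> D i a `<=` D i b.

(** Minimise the first set, then compare the rest among the minimisers. Different elements may have
    equal families, whence the second alternative. *)
Lemma lex_least s (B : set A) : B !=set0 ->
  exists2 a, B a & forall b, B b -> lex s a b \/ forall i, i \in s -> D i a = D i b.
Proof.
elim: s B => [|i s IH] B B0 /=; first by case: B0 => a Ba; exists a => //; right.
have [a Ba aL] := D_least i B0.
have [|b [Bb Dba] bL] := IH (B `&` [set b | D i b = D i a]); first by exists a.
exists b => // c Bc; rewrite Dba.
have [le|nle] := EM (D i c `<=` D i a); last by left; left; split=> //; exact: aL.
have E : D i c = D i a by apply/seteqP; split=> //; exact: aL.
have [|l|l] := bL c; first by [].
  by left; right.
by right=> j; rewrite in_cons => /orP[/eqP ->|/l //]; rewrite E.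
Qed.

(** Comparability comes from minimising over the pair [[set a; b]]. *)
Lemma lex_total s a b :
  [\/ lex s a b, lex s b a | forall i, i \in s -> D i a = D i b].
Proof.
have [|c [->|->] L] := @lex_least s [set a; b]; first by exists a; left.
  by have [|l|l] := L b; [right|constructor 1|constructor 3].
have [|l|l] := L a; [by left|by constructor 2|constructor 3 => i /l //].
Qed.

End Lexicographic.

(** * Equivalent histories and equality of structures *)

Section Equivalence.
Variables (V T : Type) (G : signature) (H K : structure V T).
Hypotheses (hH : history G H) (hHK : equivalent G H K).
Implicit Types e : event V T.

Lemma equivalent_sub e : ev H e -> ev K e.
Proof.
move=> He; have [pe _ _] := hist_ids hH He.
have /= E := congr1 (@ev V T) (hHK pe).
by have : (ev H `&` [set e' | proc e' = proc e]) e by []; rewrite E => -[].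
Qed.

End Equivalence.

Lemma equivalent_sym (V T : Type) (G : signature) (H K : structure V T) :
  equivalent G H K -> equivalent G K H.
Proof. by move=> E i ip; rewrite E. Qed.

Lemma eq_structure (V T : Type) (H K : structure V T) :
  (forall e, ev H e <-> ev K e) -> (forall e e', prec H e e' <-> prec K e e') -> H = K.
Proof.
case: H K => [E p] [F q] /= h1 h2; congr Structure; first by apply/seteqP; split=> e /h1.
by apply/funext => e; apply/funext => e'; apply/propext.
Qed.

(** Since [H] is total and [K] asymmetric, preserving the order already gives reflecting it. *)
Lemma sub_prec_iff (V T : Type) (G : signature) (H K : structure V T) e e' :
  history G H -> history G K -> ev H e -> ev H e' ->
  (prec H e e' -> prec K e e') -> (prec H e' e -> prec K e' e) ->
  prec H e e' <-> prec K e e'.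
Proof.
move=> hH hK He He' s s'; split=> // p.
have [|//|/s' q] := prec_total hH He He'; first exact: (prec_neq hK p).
by case: (prec_asym hK p).
Qed.

(** * The merged order on calls and its linear extension *)

Definition calls (V T : Type) (H : structure V T) : set (nat * nat) :=
  [set call e | e in ev H].

Section LinearExtension.
Variables (V T : Type) (G : signature) (K : structure V T) (L : nat -> structure V T).
Hypothesis hK : history G K.
Hypothesis seqL : forall x, x \in objs G -> sequential G (L x).
Hypothesis eqL : forall x, x \in objs G -> equivalent G (proj_obj K x) (L x).
Hypothesis precL : forall x m m', x \in objs G ->
  call_prec (proj_obj K x) m m' -> call_prec (L x) m m'.
Implicit Types (x i : nat) (e : event V T) (m p q : nat * nat).

Lemma proj_obj_history x : history G (proj_obj K x).
Proof. by case: (proj_obj_greatest hK x). Qed.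

Lemma ev_seqL x e : x \in objs G -> ev (L x) e <-> ev K e /\ obj e = x.
Proof.
move=> xo; split.
  exact: (equivalent_sub (seqL xo).1 (equivalent_sym (eqL xo))).
exact: (equivalent_sub (proj_obj_history x) (eqL xo)).
Qed.

Definition obj_prec m m' := exists2 x, x \in objs G & call_prec (L x) m m'.
Definition obj_preceq m m' := m = m' \/ obj_prec m m'.

(** The middle call is on one object only, so both precedences come from the same [L x]. *)
Lemma obj_prec_trans m p q : obj_prec m p -> obj_prec p q -> obj_prec m q.
Proof.
move=> [x xo a] [y yo b].
have [_ [i [_ [_ ci] /(prec_evr (seqL xo).1)/(ev_seqL _ xo)[Ki ix]]]] := a.
have [r [_ [[_ cr] _ /(prec_evl (seqL yo).1)/(ev_seqL _ yo)[Kr ry]]]] := b.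
have E : x = y by rewrite -ix -ry; apply: (same_call_obj hK); rewrite // ci.
by rewrite -{}E in b; exists x => //; exact: (call_prec_trans (seqL xo).1 a b).
Qed.

Lemma obj_preceq_trans m p q : obj_preceq m p -> obj_preceq p q -> obj_preceq m q.
Proof. by move=> [->//|a] [<-|b]; right => //; exact: obj_prec_trans b. Qed.

Lemma obj_prec_irr m : ~ obj_prec m m.
Proof. by move=> [x xo /(call_prec_irr (seqL xo).1)]. Qed.

(** Calls related by [L x] are both on [x], so a precedence of [K] between them is one of its
    projection on [x], which [L x] respects. Opposite precedences would give a cycle in [L x]. *)
Lemma obj_preceq_call_prec p q : obj_preceq q p -> ~ call_prec K p q.
Proof.
move=> [->|[x xo a]] b; first exact: (call_prec_irr hK b).
have [r [i [[rr cr] [ii ci] ri]]] := a.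
have [r0 [i0 [[rr0 cr0] [ii0 ci0] ri0]]] := b.
have [Kr rx] := (ev_seqL _ xo).1 (prec_evl (seqL xo).1 ri).
have [Ki ix] := (ev_seqL _ xo).1 (prec_evr (seqL xo).1 ri).
suff : call_prec (proj_obj K x) p q.
  by move/(precL xo)/(call_prec_trans (seqL xo).1 a)/(call_prec_irr (seqL xo).1).
exists r0, i0; split=> //; split=> //=.
  by rewrite -ix; apply: (same_call_obj hK (prec_evl hK ri0) Ki); rewrite cr0.
by rewrite -rx; apply: (same_call_obj hK (prec_evr hK ri0) Kr); rewrite ci0.
Qed.

Lemma call_prec_interval p q p' q' : call_prec K p q -> obj_preceq q p' ->
  call_prec K p' q' -> call_prec K p q'.
Proof.
move=> [r [i [hr hi ri]]] /obj_preceq_call_prec np [r' [i' [hr' hi' ri']]].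
have ne : i <> r' by move=> E; case: hi hr' => + _ [+ _]; rewrite E /is_resp => ->.
have [a|a] := prec_total hK (prec_evr hK ri) (prec_evl hK ri') ne.
  by exists r, i'; split=> //; exact: (prec_trans hK ri (prec_trans hK a ri')).
by case: np; exists r', i.
Qed.

(* By [call_prec_interval], this is the transitive closure of the union of
   [obj_prec] and [call_prec K]. *)
Definition merged m m' := obj_prec m m' \/
  exists p q, [/\ obj_preceq m p, call_prec K p q & obj_preceq q m'].

(** A cycle can be rotated until its two object segments join, leaving one precedence of [K] against
    one object segment. *)
Lemma merged_irr m : ~ merged m m.
Proof.
move=> [/obj_prec_irr//|[p [q [a b c]]]].
exact: (obj_preceq_call_prec (obj_preceq_trans c a) b).
Qed.

Lemma merged_trans m p q : merged m p -> merged p q -> merged m q.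
Proof.
move=> [a|[s [t [a b c]]]] [a'|[s' [t' [a' b' c']]]].
- by left; exact: (obj_prec_trans a a').
- right; exists s', t'; split=> //; apply: obj_preceq_trans a'; by right.
- right; exists s, t; split=> //; apply: (obj_preceq_trans c); by right.
(* The two precedences of [K] absorb the object segment between them. *)
- right; exists s, t'; split=> //.
  exact: (call_prec_interval b (obj_preceq_trans c a') b').
Qed.

Lemma call_prec_merged m m' : call_prec K m m' -> merged m m'.
Proof. by right; exists m, m'; split=> //; left. Qed.

Lemma obj_prec_calls m m' : obj_prec m m' -> calls K m'.
Proof.
move=> [x xo [r [i [_ [_ <-] /(prec_evr (seqL xo).1)/(ev_seqL _ xo)[Ki _]]]]].
by exists i.
Qed.

Lemma merged_calls m m' : merged m m' -> calls K m'.
Proof.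
move=> [/obj_prec_calls//|[p [q [_ b [<-|/obj_prec_calls//]]]]].
by have [r [i [_ [_ <-] /(prec_evr hK) Ki]]] := b; exists i.
Qed.

Lemma program_order m m' : calls K m -> calls K m' -> m.1 = m'.1 -> m <> m' ->
  call_prec K m m' \/ call_prec K m' m.
Proof.
move=> [e Ke <-] [e' Ke' <-] pp ne.
have sub : part K (proc e) `<=` ev K by move=> f [].
apply: (alternating_call_total hK sub _ (hist_wf hK _) _ _ ne) => //.
exact: match_closed_part.
Qed.

Definition below i m : set (nat * nat) :=
  [set n | [/\ calls K n, n.1 = i & n = m \/ merged n m]].

(** Program order belongs to [merged], so each [below i b] is an initial segment of the calls of
    [i]. A segment that misses the earliest call missed by any of them is the least. *)
Lemma below_least i (B : set (nat * nat)) : B !=set0 ->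
  exists2 a, B a & forall b, B b -> below i a `<=` below i b.
Proof.
move=> [a0 Ba0].
pose U n := [/\ calls K n, n.1 = i & exists2 b, B b & ~ below i b n].
have [[n0 [[e0 Ke0 ce0] n0i Bn0]]|noU] := EM (exists n, U n); last first.
  (* If no call is missed, each of these sets consists of all calls of [i], and any element of [B]
     will do. *)
  exists a0 => // b Bb n [cn ni _]; apply: contrapT => nb.
  by apply: noU; exists n; split=> //; exists b.
have [||e [[Ke Ue] eL]] := prec_least hK (A := [set e | ev K e /\ U (call e)]).
- by move=> e [].
- by exists e0; split=> //=; rewrite ce0; split=> //; exists e0.
have [ce ei [a Ba na]] := Ue.
exists a => // b Bb n an; have [[e1 Ke1 ce1] ni nam] := an.
(* A call [n] missed by [below i b] comes after [call e] in program order, so with [n] also [call e]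
   would be in [below i a]. *)
apply: contrapT => nb.
have nn : call e <> n by move=> E; apply: na; rewrite E.
have cn : calls K n by exists e1.
have ee1 : prec K e e1.
  apply: eL; last by move=> E; apply: nn; rewrite -ce1 E.
  by split=> //; rewrite ce1; split=> //; exists b.
have [|p|p] := program_order ce cn _ nn; first by rewrite ei ni.
  apply: na; split=> //; right; case: nam => [<-|]; first exact: call_prec_merged.
  by apply: merged_trans; exact: call_prec_merged.
exact: (prec_asym hK ee1 (call_prec_prec hK p Ke1 Ke ce1 erefl)).
Qed.

Definition linear_ext : nat * nat -> nat * nat -> Prop :=
  lex below (enum_fset (procs G)).

Lemma calls_proc m : calls K m -> m.1 \in enum_fset (procs G).
Proof. by move=> [e Ke <-]; have [] := hist_ids hK Ke. Qed.

(** Each call lies in the set of its own process, so equal families put [m] and [m'] each at or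
    below the other. *)
Lemma below_inj m m' : calls K m -> calls K m' ->
  (forall i, i \in enum_fset (procs G) -> below i m = below i m') -> m = m'.
Proof.
move=> cm cm' E.
have : below m.1 m m by split=> //; left.
have : below m'.1 m' m' by split=> //; left.
rewrite (E _ (calls_proc cm)) -(E _ (calls_proc cm')).
move=> [_ _ [//|a]] [_ _ [//|b]].
by have := merged_irr (merged_trans a b).
Qed.

Lemma merged_linear_ext m m' : merged m m' -> linear_ext m m'.
Proof.
move=> a; have cm' := merged_calls a; apply: lex_mono.
  move=> i n [cn ni na]; split=> //; right.
  by case: na => [->|b] //; exact: (merged_trans b a).
exists m'.1; first exact: calls_proc.
have : below m'.1 m' m' by split=> //; left.
move=> b /(_ _ b) [_ _ [E|c]]; first by rewrite E in a; exact: (merged_irr a).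
exact: (merged_irr (merged_trans a c)).
Qed.

Lemma linear_ext_total m m' : calls K m -> calls K m' -> m <> m' ->
  linear_ext m m' \/ linear_ext m' m.
Proof.
move=> cm cm' ne.
have [a|b|/below_inj E] := lex_total below_least (enum_fset (procs G)) m m'.
- by left.
- by right.
- by case: ne; exact: E.
Qed.

Lemma linear_ext_least (B : set (nat * nat)) : B `<=` calls K -> B !=set0 ->
  exists2 a, B a & forall b, B b -> b <> a -> linear_ext a b.
Proof.
move=> BK /(lex_least below_least (enum_fset (procs G)))[a Ba aL].
exists a => // b Bb ne; have [//|E] := aL b Bb.
by case: ne; apply: below_inj => //; [exact: BK|exact: BK|move=> i /E].
Qed.

End LinearExtension.

(** * The sequential history given by a well-order of the calls *)

Section Sequentialize.
Variables (V T : Type) (G : signature) (K : structure V T).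
Variable lt : nat * nat -> nat * nat -> Prop.
Hypothesis hK : history G K.
Hypothesis nK : forall e, ~ pending K e.
Hypothesis lt_irr : forall m, ~ lt m m.
Hypothesis lt_trans : forall m p q, lt m p -> lt p q -> lt m q.
Hypothesis lt_total : forall m m', calls K m -> calls K m' -> m <> m' ->
  lt m m' \/ lt m' m.
Hypothesis lt_least : forall B : set (nat * nat), B `<=` calls K -> B !=set0 ->
  exists2 a, B a & forall b, B b -> b <> a -> lt a b.
Hypothesis lt_prec : forall m m', call_prec K m m' -> lt m m'.
Implicit Types (e r : event V T).

Definition sequentialize : structure V T := Structure (ev K)
  (fun e e' => [/\ ev K e, ev K e'
    & lt (call e) (call e') \/ [/\ call e = call e', is_inv e & is_resp e']]).

Local Notation S := sequentialize.

Lemma sequentialize_wo : strict_wo S.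
Proof.
split=> /=.
- by move=> e e' [].
- move=> e [_ _ [/lt_irr//|[_ ie]]]; by rewrite /is_resp ie.
- move=> e1 e2 e3 [K1 _ [a|[c i1 r2]]] [_ K3 [b|[c' i2 r3]]]; split=> //.
  + by left; exact: (lt_trans a b).
  + by left; rewrite -c'.
  + by left; rewrite c.
  + by move: r2; rewrite /is_resp i2.
- move=> e e' Ke Ke' ne; have [c|nc] := EM (call e = call e').
    have [ie|re] := boolP (is_inv e); have [ie'|re'] := boolP (is_inv e').
    + by case: ne; apply: (hist_uniq hK); rewrite ?ie.
    + by left; split=> //; right.
    + by right; split=> //; right.
    + by case: ne; apply: (hist_uniq hK); rewrite // (negbTE re) (negbTE re').
  have [||l|l] := lt_total _ _ nc; [by exists e|by exists e'|..].
    by left; split=> //; left.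
  by right; split=> //; left.
- move=> A AK [e0 Ae0].
  have [||_ [e Ae <-] mL] := lt_least (B := [set call e | e in A]).
  + by move=> _ [e /AK Ke <-]; exists e.
  + by exists (call e0), e0.
  (* Within the least call, [f] is the invocation if [A] contains it and the response otherwise. *)
  have [f [Af cf fL]] : exists f, [/\ A f, call f = call e &
      forall g, A g -> call g = call e -> g <> f -> is_inv f /\ is_resp g].
    have [[f [Af cf if_]]|no] := EM (exists f, [/\ A f, call f = call e & is_inv f]).
      exists f; split=> // g Ag cg ne; split=> //; apply/negP => ig; apply: ne.
      by apply: (hist_uniq hK); rewrite ?if_ ?ig ?cf ?cg //; exact: AK.
    exists e; split=> // g Ag cg ne; case: ne; apply: (hist_uniq hK) => //; try exact: AK.
    have [ig|_] := boolP (is_inv g); first by case: no; exists g.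
    by have [ie|//] := boolP (is_inv e); case: no; exists e.
  exists f; split=> // g Ag ne; split; [exact: AK|exact: AK|].
  have [c|nc] := EM (call g = call e).
    by right; have [? ?] := fL g Ag c ne; split; rewrite ?cf ?c.
  by left; rewrite cf; apply: mL => //; exists g.
Qed.

(** Two events of an alternating set belong to one call or to calls ordered by [K], and [lt] extends
    the latter order. *)
Lemma sequentialize_prec A e e' : A `<=` ev K -> match_closed K A ->
  alternating K A -> A e -> A e' -> prec K e e' -> prec S e e'.
Proof.
move=> AK cA alt Ae Ae' p; split; [exact: AK|exact: AK|].
by have [|/lt_prec] := alternating_cases hK AK cA alt Ae Ae' p; [right|left].
Qed.

Lemma sequentialize_prec_proc e e' : prec K e e' -> proc e = proc e' -> prec S e e'.
Proof.
move=> p pp; have Ke := prec_evl hK p; have Ke' := prec_evr hK p.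
apply: (sequentialize_prec _ (match_closed_part (i := proc e)) (hist_wf hK _)) => //.
by move=> f [].
Qed.

(** No invocation of [K] is pending, and [S] puts nothing between the two events of a call. *)
Lemma sequentialize_alternating A : A `<=` ev K -> match_closed K A -> alternating S A.
Proof.
move=> AK cA; have [_ Sirr Str _ _] := sequentialize_wo.
have pred r : A r -> ~~ is_inv r -> exists i, [/\ A i, matching i r & prec S i r].
  move=> Ar rr; have [i [[Ki _] m _]] := resp_pred hK (AK _ Ar) rr.
  exists i; split=> //; first by apply/(cA _ _ Ki (AK _ Ar) m).
  by case: m => ii _ c _ _; split=> //; [exact: AK|right].
split.
  move=> e [Ae eL]; have [//|/(pred _ Ae)[i [Ai _ p]]] := boolP (is_inv e).
  have q : prec S e i by apply: eL => // E; rewrite E in p; exact: (Sirr _ p).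
  by have := Sirr _ (Str _ _ _ p q).
move=> e1 e2 A1 [[A2 /= p12] e2L]; case: ifP => i1.
  have [r Kr m] : exists2 r, ev K r & matching e1 r.
    by apply: contrapT => no; apply: (nK (e := e1)); split=> //; exact: AK.
  have Ar : A r by apply/(cA _ _ (AK _ A1) Kr m).
  have [_ rr c _ _] := m.
  have p1r : prec S e1 r by split=> //; [exact: AK|right].
  have [<-//|ne] := EM (r = e2).
  have [_ _ p2r] := e2L r (conj Ar p1r) ne.
  case: p12 => K1 K2 [l|[c12 _ r2]].
    case: p2r => [l'|[c' _ _]]; first by have := lt_trans l l'; rewrite c => /lt_irr.
    by move: l; rewrite c c' => /lt_irr.
  by case: ne; apply: esym; exact: (resp_uniq hK Kr K2 m r2 (esym c12)).
(* If [e2] were a response, its own invocation would lie between [e1] and [e2]. *)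
have [//|/(pred _ A2)[i [Ai m pi2]]] := boolP (is_inv e2).
case: p12 => K1 K2 [l|[_]]; last by rewrite i1.
have [ii _ c _ _] := m.
have p1i : prec S e1 i by split; [by []|exact: AK|left; rewrite c].
have ne : i <> e2 by move=> E; rewrite E in pi2; exact: (Sirr _ pi2).
by have := Sirr _ (Str _ _ _ pi2 (e2L i (conj Ai p1i) ne)).
Qed.

Lemma sequentialize_prec_procE e e' : ev K e -> ev K e' -> proc e = proc e' ->
  prec K e e' <-> prec S e e'.
Proof.
move=> Ke Ke' pp; split=> [p|q]; first exact: sequentialize_prec_proc.
have [_ Sirr Str _ _] := sequentialize_wo.
have [|//|/sequentialize_prec_proc-/(_ (esym pp)) p] := prec_total hK Ke Ke'.
  by move=> E; rewrite E in q; exact: (Sirr _ q).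
by have := Sirr _ (Str _ _ _ q p).
Qed.

Lemma sequentialize_sequential : sequential G S.
Proof.
split; last by apply: sequentialize_alternating => //; exact: match_closed_ev.
split.
- exact: sequentialize_wo.
- exact: hist_countable hK.
- exact: hist_ids hK.
- exact: hist_uniq hK.
(* [S] orders the events of one process as [K] does, so the numbering carries over. *)
- move=> i; have [f fP] := hist_omega hK i; exists f => e e' Pe Pe'.
  rewrite -fP //; case: Pe Pe' => [Ke pe] [Ke' pe'].
  by apply: iff_sym; apply: sequentialize_prec_procE => //; rewrite pe pe'.
- move=> i; apply: sequentialize_alternating; first by move=> e [].
  exact: match_closed_part.
Qed.

Lemma sequentialize_equivalent : equivalent G K S.
Proof.
move=> i _; apply: eq_structure => // e e'; split=> /= -[p pe pe']; split=> //.
  by apply: sequentialize_prec_proc => //; rewrite pe pe'.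
by have [Ke Ke' _] := p; apply/sequentialize_prec_procE; rewrite // pe pe'.
Qed.

Lemma sequentialize_call_prec m m' : call_prec K m m' -> call_prec S m m'.
Proof.
move=> p; have l := lt_prec p; have [r [e [hr he q]]] := p.
exists r, e; split=> //; split; [exact: (prec_evl hK q)|exact: (prec_evr hK q)|left].
by rewrite hr.2 he.2.
Qed.

End Sequentialize.

(** * Appending responses to pending calls *)

Section AppendResponses.
Variables (V T : Type) (G : signature) (H : structure V T) (N : set (event V T)).
Hypothesis hH : history G H.
Hypothesis N_pending : forall r, N r -> exists2 e, pending H e & matching e r.
Hypothesis N_uniq : forall r r', N r -> N r' -> call r = call r' -> r = r'.
Implicit Types e r : event V T.

Definition append_responses : structure V T := Structure (ev H `|` N)
  (fun e e' => [\/ prec H e e', ev H e /\ N e' |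
                   [/\ N e, N e' & proc e < proc e']]).

Local Notation H' := append_responses.

Lemma append_resp r : N r -> is_resp r.
Proof. by move=> /N_pending[e _ []]. Qed.

Lemma append_new r : N r -> ~ ev H r.
Proof. by move=> /N_pending[e [_ _ nex] m] Hr; apply: nex; exists r. Qed.

(** A pending invocation is the last event of its process, so both responses answer the same one.
    This makes the order by process number total on [N]. *)
Lemma append_proc_uniq r r' : N r -> N r' -> proc r = proc r' -> r = r'.
Proof.
move=> Nr Nr' pp; have [e pe [_ _ c _ _]] := N_pending Nr.
have [e' pe' [_ _ c' _ _]] := N_pending Nr'.
apply: N_uniq => //; rewrite -c -c'; have [He _ _] := pe; have [He' _ _] := pe'.
have pee' : proc e = proc e' by case: c c' => -> _ [-> _].
have [->//|p] := pending_last hH pe' He pee'.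
have [->//|q] := pending_last hH pe He' (esym pee').
by case: (prec_asym hH p q).
Qed.

Lemma append_prec_old e e' : ev H e' -> prec H' e e' <-> prec H e e'.
Proof.
by move=> He'; split=> [[//|[_ /append_new]|[_ /append_new]]|] //; constructor 1.
Qed.

Lemma append_prec_new e r : N r -> proc e = proc r -> prec H' e r <-> ev H e.
Proof.
move=> Nr pp; split=> [[/(prec_evr hH)/(append_new Nr)//|[]//|[_ _]]|He].
  by rewrite pp ltnn.
by constructor 2.
Qed.

Lemma append_wo : strict_wo H'.
Proof.
split=> /=.
- move=> e e' [p|[He Ne']|[Ne Ne' _]]; last by split; right.
    by split; left; [exact: (prec_evl hH p)|exact: (prec_evr hH p)].
  by split; [left|right].
- by move=> e [/(prec_irr hH)//|[He /append_new]//|[_ _]]; rewrite ltnn.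
- move=> e1 e2 e3 [p|[H1 N2]|[N1 N2 l]] [q|[H2 N3]|[N2' N3 l']].
  + by constructor 1; exact: (prec_trans hH p q).
  + by constructor 2; split=> //; exact: (prec_evl hH p).
  + by have := append_new N2' (prec_evr hH p).
  + by have := append_new N2 (prec_evl hH q).
  + by constructor 2.
  + by constructor 2.
  + by have := append_new N2 (prec_evl hH q).
  + by have := append_new N2.
  + by constructor 3; split=> //; exact: (ltn_trans l l').
- move=> e e' [He|Ne] [He'|Ne'] ne.
  + by have [p|p] := prec_total hH He He' ne; [left|right]; constructor 1.
  + by left; constructor 2.
  + by right; constructor 2.
  + have [l|l|E] := ltngtP (proc e) (proc e'); last by case: ne; exact: append_proc_uniq.
      by left; constructor 3.
    by right; constructor 3.
- move=> A AH' [e0 Ae0].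
  (* Old events come before all new ones; if [A] has no old event, the smallest process number
     decides. *)
  have [[e1 [Ae1 He1]]|no] := EM (exists e, A e /\ ev H e).
    have [||e [[Ae He] eL]] := prec_least hH (A := A `&` ev H).
    + by move=> e [].
    + by exists e1.
    exists e; split=> // e' Ae' ne; case: (AH' _ Ae') => [He'|Ne'].
      by constructor 1; exact: eL.
    by constructor 2.
  have AN e : A e -> N e by move=> Ae; case: (AH' _ Ae) => // He; case: no; exists e.
  have exn : exists n, `[< exists2 e, A e & proc e = n >].
    by exists (proc e0); apply/asboolP; exists e0.
  case: (ex_minnP exn) => n /asboolP[e Ae pe] nL.
  exists e; split=> // e' Ae' ne; constructor 3; split; [exact: AN|exact: AN|].
  rewrite ltn_neqAle; apply/andP; split.
    by apply/eqP => E; apply: ne; apply: append_proc_uniq (esym E); exact: AN.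
  by rewrite pe; apply: nL; apply/asboolP; exists e'.
Qed.

Lemma append_countable : countable (ev H').
Proof.
have -> : ev H' = \bigcup_k bigcup2 (ev H) N k by rewrite bigcup2E.
apply: bigcup_countable; first exact: countableP.
move=> [|[|k]] _ //=; first exact: (hist_countable hH).
apply/countable_injP; exists (@proc V T) => r r' /[!inE].
exact: append_proc_uniq.
Qed.

Lemma append_history : history G H'.
Proof.
(* An old response belonging to the call of [r] would answer the pending invocation. *)
have old_call r e : N r -> ev H e -> is_inv r = is_inv e -> call r <> call e.
  move=> Nr He ii c; have [e0 [He0 i0 nex] m] := N_pending Nr.
  have [_ rr c0 _ _] := m; have re : is_resp e by rewrite /is_resp -ii.
  have [m' _] := inv_resp hH He0 He i0 re (etrans c0 c).
  by apply: nex; exists e.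
split.
- exact: append_wo.
- exact: append_countable.
- move=> r [/(hist_ids hH)//|/N_pending[e [He _ _] [_ _ [<- _] <- <-]]].
  exact: (hist_ids hH).
- move=> e e' [He|Ne] [He'|Ne'] ii c.
  + exact: (hist_uniq hH).
  + by case: (old_call _ _ Ne' He).
  + by case: (old_call _ _ Ne He').
  + exact: N_uniq.
- move=> i; have [f fP] := hist_omega hH i.
  have [[r [Nr pr]]|no] := EM (exists r, N r /\ proc r = i); last first.
    have old e : part H' i e -> ev H e.
      by move=> [[//|Ne] pe]; case: no; exists e.
    exists f => e e' Pe Pe'; rewrite append_prec_old; last exact: old.
    by apply: fP; split; [exact: old|exact: Pe.2|exact: old|exact: Pe'.2].
  have [e0 pe0 [_ _ [p0 _] _ _]] := N_pending Nr.
  have Pe0 : part H i e0 by split; [case: pe0|rewrite /= p0].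
  have le0 e : part H i e -> f e <= f e0.
    move=> Pe; have [||->//|p] := pending_last hH pe0 (e' := e); first exact: Pe.1.
      by rewrite p0 pr Pe.2.
    by apply/ltnW/fP.
  (* The pending [e0] has the largest number among the old events of [i], so the new response gets
     the next one. *)
  exists (fun e => if `[< N e >] then (f e0).+1 else f e) => e e'.
  have notN x : ev H x -> `[< N x >] = false.
    by move=> Hx; apply/asboolP => /append_new.
  move=> [[He|Ne] pe] [[He'|Ne'] pe'].
  + by rewrite append_prec_old // !notN //; exact: fP.
  + rewrite append_prec_new //; last by rewrite pe pe'.
    by rewrite (notN _ He) (asboolT Ne') ltnS; split=> // _; exact: le0.
  + rewrite append_prec_old // (notN _ He') (asboolT Ne); split.
      by move/(prec_evl hH)/(append_new Ne).
    by rewrite ltnNge (leq_trans (le0 _ (conj He' pe')) (leqnSn _)).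
  + rewrite append_prec_new //; last by rewrite pe pe'.
    by rewrite !asboolT // ltnn; split=> // /(append_new Ne).
- move=> i; have [w1 w2] := hist_wf hH i; split.
    move=> e [[[He|Ne] pe] eL].
      apply: w1; split=> // e' [He' pe'] ne.
      by apply/append_prec_old => //; apply: eL => //; split=> //; left.
    have [e0 [He0 i0 _] [_ _ [p0 _] _ _]] := N_pending Ne.
    have : prec H' e e0.
      apply: eL; first by split; [left|rewrite /= p0].
      by move=> E; apply: (append_new Ne); rewrite -E.
    by move/(append_prec_old _ He0)/(prec_evl hH)/(append_new Ne).
  move=> e1 e2 [H1 p1] [[[[H2|N2] p2] /= p12] e2L].
    move/(append_prec_old _ H2): p12 => p12.
    apply: w2; first by split=> //; exact: (prec_evl hH p12).
    split=> // e [[He pe] p1e] ne; apply/(append_prec_old _ He)/e2L => //.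
    by split; [split=> //; left|constructor 1].
  have pp : proc e1 = proc e2 by rewrite p1 p2.
  move/(append_prec_new N2 pp): p12 => He1.
  have [e0 pe0 m] := N_pending N2; have [_ _ [p0 _] _ _] := m.
  have [He0 i0 _] := pe0.
  (* [e1] is the pending invocation [e0], since otherwise [e0] would lie between [e1] and [e2]. *)
  have [|E|q] := pending_last hH pe0 He1; first by rewrite p0.
    by rewrite E i0.
  have : prec H' e2 e0.
    apply: e2L; last by move=> E; apply: (append_new N2); rewrite -E.
    by split; [split; [left|rewrite /= p0]|constructor 1].
  by move/(append_prec_old _ He0)/(prec_evl hH)/(append_new N2).
Qed.

End AppendResponses.

(** * Merging the sequential histories of the objects *)

Lemma merge_sequential (V T : Type) (G : signature) (K : structure V T)
    (L : nat -> structure V T) :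
  history G K -> (forall e, ~ pending K e) ->
  (forall x, x \in objs G -> [/\ sequential G (L x), equivalent G (proj_obj K x) (L x)
    & forall m m', call_prec (proj_obj K x) m m' -> call_prec (L x) m m']) ->
  exists S, [/\ sequential G S, equivalent G K S,
    forall m m', call_prec K m m' -> call_prec S m m'
    & forall x, x \in objs G -> proj_obj S x = L x].
Proof.
move=> hK nK hL.
have seqL x : x \in objs G -> sequential G (L x) by move=> /hL[].
have eqL x : x \in objs G -> equivalent G (proj_obj K x) (L x) by move=> /hL[].
have precL x m m' : x \in objs G ->
    call_prec (proj_obj K x) m m' -> call_prec (L x) m m'.
  by move=> /hL[_ _]; apply.
set lt := linear_ext G K L.
have ltirr m : ~ lt m m by exact: lex_irr.
have lttr m p q : lt m p -> lt p q -> lt m q by exact: lex_trans.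
have lttot := linear_ext_total hK seqL eqL precL.
have ltleast := linear_ext_least hK seqL eqL precL.
have ltmerged := merged_linear_ext hK seqL eqL precL.
have ltprec m m' : call_prec K m m' -> lt m m'.
  by move=> /(call_prec_merged G L); exact: ltmerged.
have hS := sequentialize_sequential hK nK ltirr lttr lttot ltleast ltprec.
exists (sequentialize K lt); split=> //.
- exact: (sequentialize_equivalent hK ltirr lttr lttot ltleast ltprec).
- by move=> m m'; apply: (sequentialize_call_prec hK ltprec).
move=> x xo; have [hLx aLx] := seqL x xo.
have evE e := ev_seqL hK seqL eqL e xo.
(* In [L x] two events belong to one call or to calls ordered by [obj_prec]; [merged], and so [lt],
   contains that order. *)
have sub e e' : prec (L x) e e' -> prec (proj_obj (sequentialize K lt) x) e e'.
  move=> p; have Le := prec_evl hLx p; have Le' := prec_evr hLx p.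
  have [[Ke ex] [Ke' ex']] := ((evE e).1 Le, (evE e').1 Le').
  split=> //; split=> //.
  have [|c] := alternating_cases hLx (fun _ => id) (@match_closed_ev _ _ _) aLx Le Le' p.
    by right.
  by left; apply: ltmerged; left; exists x.
apply: eq_structure => [e|e e']; first by apply: iff_sym; exact: evE.
split=> [p|]; last exact: sub.
have hP : history G (proj_obj (sequentialize K lt) x) by exact: (proj_obj_history hS.1).
apply/(sub_prec_iff hLx hP) => //; try exact: sub; apply/evE.
  exact: (prec_evl hP p).
exact: (prec_evr hP p).
Qed.

(** * Linearizability passes to object subhistories *)

Lemma restrict_sequential (V T : Type) (G : signature) (H : structure V T) A :
  sequential G H -> match_closed H A -> sequential G (Defs.restrict H A).
Proof.
move=> [hH alt] cA; have hK := restrict_history hH cA.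
split=> //; set K := Defs.restrict H A in hK *; split.
  move=> e [Ke eL]; have [//|re] := boolP (is_inv e).
  have [e0 [[Ke0 _] _ [[_ p0] _]]] := resp_pred hK Ke re.
  have p : prec K e e0 by apply: eL => //; exact: (prec_neq hK p0).
  by case: (prec_asym hK p).
move=> e1 e2 [H1 A1] [[[H2 A2] /= p12] e2L].
have q12 : prec H e1 e2 by case: p12.
case: ifP => i1.
  have [||s Ls] := prec_least hH (A := ev H `&` above H e1).
  - by move=> x [].
  - by exists e2.
  have := alt.2 _ _ H1 Ls; rewrite i1 => m; have [[Hs p1s] sL] := Ls.
  have As : A s by apply/(cA _ _ H1 Hs m).
  have [->//|ne] := EM (e2 = s).
  have [|p2s _ _] := e2L s _ (fun E => ne (esym E)); first by split; split.
  by case: (prec_asym hH p2s); exact: sL.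
have [//|r2] := boolP (is_inv e2).
have [e0 [[K0 _] m [[_ p02] _]]] := resp_pred hK (conj H2 A2) r2.
have [i0 _ c02 _ _] := m; have [q02 _ _] := p02.
have ne : e1 <> e0 by move=> E; rewrite E i0 in i1.
have [p10|p01] := prec_total hK (conj H1 A1) K0 ne.
  by case: (prec_asym hK p02); apply: e2L => //; exact: (prec_neq hK p02).
have [q01 _ _] := p01.
(* With [e0] before [e1], either [e1] is the response [e2], or the call of [e0] and [e2] is over
   before [e1]. *)
have [[c _ r1]|c] :=
  alternating_cases hH (fun _ => id) (@match_closed_ev _ _ _) alt K0.1 H1 q01.
  by case: (prec_neq hH q12 (resp_uniq hH H2 H1 m r1 (esym c))).
by case: (prec_asym hH q12); exact: (call_prec_prec hH c H2 H1 (esym c02) erefl).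
Qed.

Lemma restrictC (V T : Type) (H : structure V T) A B :
  Defs.restrict (Defs.restrict H A) B = Defs.restrict (Defs.restrict H B) A.
Proof.
apply: eq_structure => [e|e e'] /=; first by split=> -[[? ?] ?].
by split=> -[[? ? ?] ? ?].
Qed.

Lemma proj_obj_id (V T : Type) (H : structure V T) x :
  proj_obj (proj_obj H x) x = proj_obj H x.
Proof.
apply: eq_structure => [e|e e'] /=; first by split=> [[[? ?] _]|[? ?]].
by split=> [[[? ? ?] _ _]|[? ? ?]].
Qed.

(** A response matching an event on [x] is on [x] too, so projecting does not change which
    invocations on [x] are pending. *)
Lemma cmplt_proj_obj (V T : Type) (H : structure V T) x :
  cmplt (proj_obj H x) = proj_obj (cmplt H) x.
Proof.
have pE e : obj e = x -> pending (proj_obj H x) e <-> pending H e.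
  move=> ex; split=> -[He ie nex]; split=> //; try by case: He.
    by move=> [r Hr m]; apply: nex; exists r => //; split=> //; case: m => _ _ _ /= <-.
  by move=> [r [Hr _] m]; apply: nex; exists r.
apply: eq_structure => [e|e e'] /=.
  split=> [[[He ex] np]|[[He np] ex]].
    by do 2!split=> //; move/(pE _ ex).
  by split=> //; move/(pE _ ex).
split=> [[[p ex ex'] np np']|[[p np np'] ex ex']].
  by do 2!split=> //; [move/(pE _ ex)|move/(pE _ ex')].
by split=> //; [move/(pE _ ex)|move/(pE _ ex')].
Qed.

Lemma linearizable_proj_obj (V T : Type) (C : system V T) (H : structure V T) x :
  x \in objs C -> linearizable C H -> linearizable C (proj_obj H x).
Proof.
move=> xo [H' [S [[hH' [sev sprec] rH'] [seqS legS eqS] precS]]].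
have cx : match_closed S [set e | obj e = x].
  by move=> e r _ _ [_ _ _ /= E _]; rewrite E.
exists (proj_obj H' x), (proj_obj S x); split.
- split; first exact: (proj_obj_history hH').
    split=> [e [/sev] |e e' [/sprec]] //.
  by move=> e [[H'e ex] ne]; apply: rH'; split=> // He; apply: ne.
- split; first exact: restrict_sequential.
    move=> y yo; have [->|ne] := EM (y = x); first by rewrite proj_obj_id; exact: legS.
    (* For [y] other than [x] the projection is empty, hence a prefix of [proj_obj S y], and the
       specification of [y] is prefix-closed. *)
    apply: (specP yo).2 (legS _ yo) _ _.
      exact: (proj_obj_history (proj_obj_history seqS.1 x)).
    have no e : ~ ev (proj_obj (proj_obj S x) y) e.
      by move=> [[_ /= ex] /= ey]; apply: ne; rewrite -ex.
    split; last by move=> e e' /no.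
    by split=> [e /no//|e e' [[p _ _] ey ey']].
  move=> i ip; rewrite cmplt_proj_obj /proj_proc /proj_obj restrictC [RHS]restrictC.
  by rewrite -/(proj_proc _ i) -/(proj_proc S i) (eqS i ip).
move=> m m' ne; rewrite cmplt_proj_obj => -[r [e [[rr cr] [ie ce] [p rx ex]]]].
have hK : history C (cmplt H') by case: (cmplt_greatest hH').
have [|r0 [e0 [[rr0 cr0] [ie0 ce0] q]]] := precS m m' ne; first by exists r, e.
(* The witnesses [r0] and [e0] share their calls with [r] and [e], which are events of [S] by
   equivalence, so they too are on [x]. *)
have hS := seqS.1; exists r0, e0; split=> //; split=> //=.
  rewrite -rx; apply: (same_call_obj hS (prec_evl hS q)); last by rewrite cr0.
  exact: (equivalent_sub hK eqS (prec_evl hK p)).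
rewrite -ex; apply: (same_call_obj hS (prec_evr hS q)); last by rewrite ce0.
exact: (equivalent_sub hK eqS (prec_evr hK p)).
Qed.

(** * Linearizability from that of the object subhistories *)

Section ResponseExtension.
Variables (V T : Type) (G : signature) (H H1 : structure V T) (x : nat).
Hypotheses (hH : history G H) (h1 : history G H1).
Hypothesis s1 : subhist (proj_obj H x) H1.
Hypothesis r1 : forall e, ev (diff H1 (proj_obj H x)) e -> is_resp e.

(** An added event is a response whose invocation is old. That invocation is pending in [H], because
    an old response to it would be the same event by uniqueness in [H1]. *)
Lemma response_extension_ev e : ev H1 e ->
  obj e = x /\ (ev H e \/ exists2 e0, pending H e0 & matching e0 e).
Proof.
move=> He; have [[? ?]|ne] := EM (ev (proj_obj H x) e); first by split=> //; left.
have re : is_resp e by apply: r1.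
have [e0 [[He0 _] m _]] := resp_pred h1 He re.
have [i0 _ _ oe _] := m.
have [H0 e0x] : ev (proj_obj H x) e0.
  by apply: contrapT => n0; have := r1 (conj He0 n0); rewrite /is_resp i0.
split; first by rewrite -oe.
right; exists e0 => //; split=> // -[r Hr m'].
have Pr : ev (proj_obj H x) r by split=> //; case: m' => _ _ _ /= <-.
have [_ rr c' _ _] := m'; apply: ne.
by rewrite -(resp_uniq h1 He (s1.1 _ Pr) m rr (esym c')).
Qed.

End ResponseExtension.

Lemma linearizable_of_proj_obj (V T : Type) (C : system V T) (H : structure V T) :
  history C H -> (forall x, x \in objs C -> linearizable C (proj_obj H x)) ->
  linearizable C H.
Proof.
move=> hH lin.
pose lin_of x (P : structure V T * structure V T) := 
  [/\ [/\ history C P.1, subhist (proj_obj H x) P.1 &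
          forall e, ev (diff P.1 (proj_obj H x)) e -> is_resp e],
      [/\ sequential C P.2, legal C P.2 & equivalent C (cmplt P.1) P.2]
    & forall m m', m <> m' -> call_prec (cmplt P.1) m m' -> call_prec P.2 m m'].
have /choice[P PP] : forall x, exists P, x \in objs C -> lin_of x P.
  (* Identifiers outside the system get the dummy pair [(H, H)]. *)
  move=> x; have [xo|nxo] := EM (x \in objs C); last by exists (H, H).
  by have [H1 [S1 h]] := lin x xo; exists (H1, S1).
pose N r := exists2 x, x \in objs C & ev (P x).1 r /\ ~ ev H r.
have evP x e : x \in objs C -> ev (P x).1 e ->
    obj e = x /\ (ev H e \/ exists2 e0, pending H e0 & matching e0 e).
  move=> xo; have [[h1 s1 r1] _ _] := PP x xo.
  exact: (response_extension_ev h1 s1 r1).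
have Npend r : N r -> exists2 e, pending H e & matching e r.
  by move=> [x xo [/(evP _ _ xo)[_ [//|//]] nHr]].
have Nuniq r r' : N r -> N r' -> call r = call r' -> r = r'.
  move=> Nr Nr' c; have [e pe m] := Npend r Nr; have [e' pe' m'] := Npend r' Nr'.
  have [ie rr ce oe _] := m; have [ie' rr' ce' oe' _] := m'.
  have [[He _ _] [He' _ _]] := (pe, pe').
  (* Both responses answer the same pending invocation, so they are on one object and come from the
     same [(P x).1], where responses are unique. *)
  have E : e = e' by apply: (hist_uniq hH) => //; rewrite ?ie ?ie' // ce ce'.
  have oo : obj r = obj r' by rewrite -oe -oe' E.
  have [x xo [Pr _]] := Nr; have [x' xo' [Pr' _]] := Nr'.
  have Ex : x = x' by rewrite -(evP _ _ xo Pr).1 -(evP _ _ xo' Pr').1.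
  rewrite -{}Ex in Pr'; have [[h1 _ _] _ _] := PP x xo.
  by apply: (hist_uniq h1) => //; move: rr rr' => /negbTE -> /negbTE ->.
set H' := append_responses H N.
have hH' : history C H' := append_history hH Npend Nuniq.
have [hK _ nK _] := cmplt_greatest hH'.
have evE x e : x \in objs C -> ev (P x).1 e <-> ev H' e /\ obj e = x.
  move=> xo; have [[h1 s1 r1] _ _] := PP x xo; split=> [Pe|[[He|[y yo [Pe _]]] ex]].
  - have [ex _] := evP _ _ xo Pe; split=> //.
    by have [He|nHe] := EM (ev H e); [left|right; exists x].
  - by apply: s1.1.
  - by rewrite -ex (evP _ _ yo Pe).1.
have sub_old x e e' : x \in objs C -> prec H e e' -> obj e = x -> obj e' = x ->
    prec (P x).1 e e'.
  by move=> xo p ex ex'; have [[_ s1 _] _ _] := PP x xo; exact: s1.2.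
(* Only events of one process are compared: between processes, [(P x).1] may order the appended
   responses differently. *)
have sub x e e' : x \in objs C -> prec H' e e' -> proc e = proc e' ->
    obj e = x -> obj e' = x -> prec (P x).1 e e'.
  move=> xo p pp ex ex'; have [[h1 s1 _] _ _] := PP x xo.
  case: p => [p|[He Ne']|[_ _]]; [exact: sub_old| |by rewrite pp ltnn].
  have [a pa m] := Npend _ Ne'; have [_ _ [pa' _] oa _] := m.
  have Pe' : ev (P x).1 e' by apply/evE => //; split=> //; right.
  have [Ha _ _] := pa.
  have Pa : ev (P x).1 a by apply: s1.1; split=> //=; rewrite oa.
  have pae := matching_prec h1 Pa Pe' m.
  (* The pending invocation [a] is the last old event of its process, so [e] is [a] or precedes it,
     and [a] precedes its response [e']. *)
  have [|->//|q] := pending_last hH pa He; first by rewrite pp.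
  by apply: (prec_trans h1 _ pae); apply: sub_old => //; rewrite oa.
have pendE x e : x \in objs C -> obj e = x -> pending (P x).1 e <-> pending H' e.
  move=> xo ex; split=> -[He ie nex].
    split=> //; first by case/evE: He.
    move=> [r Hr m]; apply: nex; exists r => //; apply/evE => //; split=> //.
    by case: m => _ _ _ <-.
  split=> //; first by apply/evE.
  by move=> [r /(evE _ _ xo)[Hr _] m]; apply: nex; exists r.
have hL x : x \in objs C -> [/\ sequential C (P x).2,
    equivalent C (proj_obj (cmplt H') x) (P x).2
    & forall m m', call_prec (proj_obj (cmplt H') x) m m' -> call_prec (P x).2 m m'].
  move=> xo; have [[h1 s1 _] [seq1 _ eq1] prec1] := PP x xo.
  have [hK1 _ _ _] := cmplt_greatest h1.
  split=> //.
    move=> i ip; rewrite -(eq1 i ip); apply: eq_structure => [e|e e'] /=.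
      split=> [[[[He np] ex] ei]|[[Pe np] ei]].
        by split=> //; split; [apply/evE|move/(pendE _ _ xo ex)].
      have [He ex] := (evE _ _ xo).1 Pe; do 3!split=> //.
        by move/(pendE _ _ xo ex).
    split=> [[[[p np np'] ex ex'] ei ei']|[[p np np'] ei ei']].
      split=> //; split; [by apply: sub => //; rewrite ei|..].
        by move/(pendE _ _ xo ex).
      by move/(pendE _ _ xo ex').
    have [He ex] := (evE _ _ xo).1 (prec_evl h1 p).
    have [He' ex'] := (evE _ _ xo).1 (prec_evr h1 p).
    do 2!split=> //; split; first last.
    - by move/(pendE _ _ xo ex').
    - by move/(pendE _ _ xo ex).
    by apply/(sub_prec_iff hH' h1) => // q; apply: sub; rewrite // ei.
  move=> m m' [r [e [[rr cr] [ie ce] [[p np np'] rx ex]]]].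
  (* Invocations are never appended, and only old events precede an old one, so this is a precedence
     of [H]. *)
  have He : ev H e.
    case: (prec_evr hH' p) => // /(append_resp Npend); by rewrite /is_resp ie.
  have {}p : prec H r e by apply/(append_prec_old Npend).
  have c : call_prec (cmplt (P x).1) m m'.
    exists r, e; split=> //; split; first exact: sub_old.
      by move/(pendE _ _ xo rx).
    by move/(pendE _ _ xo ex).
  by apply: prec1 => // E; rewrite E in c; exact: (call_prec_irr hK1 c).
have [S [seqS eqS precS projS]] := merge_sequential hK nK hL.
exists H', S; split; last by move=> m m' _; exact: precS.
  split=> //; first by split=> [e He|e e' p]; [left|constructor 1].
  by move=> e [[//|/(append_resp Npend)//]].
(* Legality of [(P x).2] concerns its own projection on [x], hence the double projection. *)
split=> // x xo; rewrite -proj_obj_id (projS x xo).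
by have [_ [_ + _] _] := PP x xo; apply.
Qed.

Theorem theorem16 (V T : Type) (C : system V T) (H : structure V T)
    (hH : history C H) :
  linearizable C H <->
  (forall x : nat, x \in objs C -> linearizable C (proj_obj H x)).
Proof.
split=> [lin x xo|]; first exact: linearizable_proj_obj.
exact: linearizable_of_proj_obj.
Qed.
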